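(* Let $G\in\mathcal{H}$. Then for every Hamilton bond of $G$, the difference in the orders (numbers of vertices) of the two end-trees of the bond is not greater than 3.
   Context: Graphs are finite and loopless but may have multiple edges. A plane triangulation is a plane graph all of whose faces (including the outer one) are bounded by cycles of length 3. $\mathcal{H}$ is the family of all 2-connected plane triangulations all of whose vertices have degree at most 6. A bond of a connected graph $G$ is a minimal non-empty edge cut. A Hamilton bond of $G$ is a bond $B$ such that both components of $G\setminus B$ ($G$ with the edges of $B$ deleted) are trees; these two trees are called the end-trees of the bond. *)

(* Defs.v *)
From HB Require Import structures.
From mathcomp Require Import all_boot all_order all_algebra.
Set Implicit Arguments.
Unset Strict Implicit.
Unset Printing Implicit Defensive.

(** Finite loopless multigraphs. [ends e false] and [ends e true] are the two
    ends of the edge [e]; the order of the two ends carries no meaning. *)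
Record mgraph := MGraph {
  vertex : finType;
  edge : finType;
  ends : edge -> bool -> vertex;
  loopless : forall e, ends e false != ends e true
}.

(** A dart is an edge with a direction: [(e, b)] goes from [ends e b] to
    [ends e (~~ b)]. *)
Definition dart (G : mgraph) : finType := (edge G * bool)%type.

Section Graphs.

Variable G : mgraph.
Implicit Types (x y : dart G) (u v : vertex G) (W C X : {set vertex G})
  (F B : {set edge G}).

Definition flip x : dart G := (x.1, ~~ x.2).
Definition tail x : vertex G := ends x.1 x.2.
Definition head x : vertex G := tail (flip x).

(** As there are no loops, distinct darts at [v] lie on distinct edges. *)
Definition degree v : nat := #|[set x : dart G | tail x == v]|.

(** Below, a pair [W F] stands for the subgraph of [G] with vertex set [W]
    whose edges are the edges in [F] with both ends in [W]. *)

Definition adj W F : rel (vertex G) := fun u v =>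
  [&& u \in W, v \in W &
      [exists x : dart G, [&& x.1 \in F, tail x == u & head x == v]]].

Definition connected_sub W F : Prop :=
  W != set0 /\ {in W &, forall u v, connect (adj W F) u v}.

Definition connected_graph : Prop := connected_sub setT setT.

Definition two_connected : Prop :=
  [/\ 2 < #|vertex G|, connected_graph &
      forall v, connected_sub [set~ v] setT].

(** Cycles are closed dart walks without repeated vertices or edges. Distinctness
    of edges only matters in length 2, where it excludes going back and forth
    along one edge but still allows two parallel edges. *)
Definition is_cycle (s : seq (dart G)) : bool :=
  [&& s != [::], cycle (fun x y => head x == tail y) s,
      uniq [seq tail x | x <- s] & uniq [seq x.1 | x <- s]].

Definition acyclic_sub W F : Prop :=
  forall s : seq (dart G), is_cycle s ->
    ~ {in s, forall x, (x.1 \in F) && (tail x \in W)}.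

Definition is_tree W F : Prop := connected_sub W F /\ acyclic_sub W F.

(** Vertex sets of the components of the spanning subgraph with edge set [F]. *)
Definition components F : {set {set vertex G}} :=
  [set [set v | connect (adj setT F) u v] | u : vertex G].

Definition boundary X : {set edge G} :=
  [set e | (ends e false \in X) != (ends e true \in X)].

Definition is_edge_cut B : bool := [exists X : {set vertex G}, B == boundary X].

Definition is_bond B : bool :=
  minset (fun B' => is_edge_cut B' && (B' != set0)) B.

Definition is_hamilton_bond B : Prop :=
  is_bond B /\ {in components (~: B), forall C, is_tree C (~: B)}.

(** Embeddings of [G] in closed oriented surfaces, described by the cyclic order
    of the darts leaving each vertex: the orbits of [rot] are the sets of darts
    with a common tail. *)
Record rotation_system := RotationSystem {
  rot : dart G -> dart G;
  rot_inj : injective rot;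
  rotP : forall x y, fconnect rot x y = (tail x == tail y)
}.

Variable r : rotation_system.

(** The orbits of [face] are the boundary walks of the faces (the outer face
    included), each traversed with the face on the same side. *)
Definition face x : dart G := rot r (flip x).

(** Plane graphs, among connected graphs with at least one edge, are the embedded
    graphs of genus 0, that is #V - #E + #F = 2. *)
Definition plane : Prop :=
  connected_graph /\ #|vertex G| + fcard face (dart G) = #|edge G| + 2.

Definition plane_triangulation : Prop :=
  plane /\
  forall x, is_cycle (orbit face x) /\ size (orbit face x) = 3.

Definition in_H : Prop :=
  [/\ two_connected, plane_triangulation & forall v, degree v <= 6].

End Graphs.

(* Main.v *)
(** Let [B] be a Hamilton bond with end-trees [T1] and [T2], on [n1] and [n2]
    vertices. Euler's formula and the triangular faces give
    [(n1 - 1) + (n2 - 1) + #|B| = #E = 3 (n1 + n2) - 6], while counting degrees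
    over [T2] gives [2 (n2 - 1) + #|B| <= 6 n2]. Eliminating [#|B|] leaves
    [n1 <= n2 + 3], and the other inequality follows by symmetry. *)

Require Import Defs.
From HB Require Import structures.
From mathcomp Require Import all_boot all_order all_algebra.
From mathcomp Require Import zify.
(* [head] must denote the head of a dart rather than of a sequence. *)
Import Defs.

(** * Reachability and darts *)

Lemma connect_crossing {T : finType} {e : rel T} {A : {set T}} {x y : T} :
  connect e x y -> x \in A -> y \notin A ->
  exists u v, [/\ e u v, u \in A & v \notin A].
Proof.
case/connectP=> p; elim: p x => [|z p IHp] x /=; first by move=> _ -> ->.
case/andP=> exz pz yE xA yA.
have [zA|zA] := boolP (z \in A); first exact: (IHp z).
by exists x, z.
Qed.

Section Graph.

Set Implicit Arguments.
Unset Strict Implicit.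

Variable G : mgraph.
Implicit Types (x y : dart G) (u v : vertex G) (W X T : {set vertex G})
  (F B : {set edge G}).

Lemma flipK : involutive (@flip G).
Proof. by case=> e b; rewrite /flip /= negbK. Qed.

Lemma tail_flip x : tail (flip x) = head x.
Proof. by []. Qed.

Lemma head_flip x : head (flip x) = tail x.
Proof. by rewrite /head flipK. Qed.

Lemma same_edge x y : x.1 = y.1 -> y = x \/ y = flip x.
Proof.
case: x y => e b [e' b'] /= <-.
by case: b b' => [] []; [left | right | right | left].
Qed.

Lemma adj_sym W F : symmetric (adj W F).
Proof.
suff sub u v : adj W F u v -> adj W F v u by move=> u v; apply/idP/idP; apply: sub.
case/and3P=> uW vW /existsP[x /and3P[xF /eqP xu /eqP xv]].
rewrite /adj uW vW; apply/existsP; exists (flip x).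
by rewrite tail_flip head_flip xu xv !eqxx xF.
Qed.

(** * Edge counts of connected and of acyclic subgraphs *)

Definition inner W F : {set edge G} :=
  [set e in F | (ends e false \in W) && (ends e true \in W)].

Lemma inner_dart W F x :
  (x.1 \in inner W F) = [&& x.1 \in F, tail x \in W & head x \in W].
Proof. by case: x => e [] //=; rewrite inE /head /tail //= [X in _ && X]andbC. Qed.

(** A set [S] is grown inside [W] from one vertex, one vertex at a time. By connectedness some edge
    of [F] leaves [S] within [W]; adding its far end makes it a new inner edge. *)
Lemma connected_inner W F : connected_sub W F -> #|W| <= #|inner W F|.+1.
Proof.
case=> /set0Pn[w0 w0W] conW.
suff grow k : k < #|W| ->
    exists S : {set vertex G}, [/\ S \subset W, #|S| = k.+1 & k <= #|inner S F|].
  have W_gt0 : 0 < #|W| by apply/card_gt0P; exists w0.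
  have [|S [SW Scard]] := grow #|W|.-1; first by rewrite prednK.
  have -> : S = W by apply/eqP; rewrite eqEcard SW Scard prednK /=.
  by rewrite -ltnS prednK.
elim: k => [|k IHk] ltk.
  by exists [set w0]; rewrite sub1set w0W cards1.
have [S [SW Scard Sin]] := IHk (ltnW ltk).
have [u uS] : exists u, u \in S by apply/card_gt0P; rewrite Scard.
have [w wW wS] : exists2 w, w \in W & w \notin S.
  by apply/subsetPn; apply: contraL ltk => /subset_leq_card; rewrite Scard -leqNgt.
have [a [b [/and3P[_ bW /existsP[x /and3P[xF /eqP xa /eqP xb]]] aS bS]]] :=
  connect_crossing (conW _ _ (subsetP SW _ uS) wW) uS wS.
exists (b |: S); split; first by rewrite subUset sub1set bW.
  by rewrite cardsU1 bS Scard.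
have xS : x.1 \notin inner S F by rewrite inner_dart xb (negbTE bS) !andbF.
apply: leq_ltn_trans Sin (proper_card _); apply/properP; split.
  apply/subsetP => e; rewrite !inE => /and3P[-> -> ->].
  by rewrite !orbT.
by exists x.1; rewrite // inner_dart xF xa xb !inE eqxx aS orbT.
Qed.

(* A walk that never turns back traces a cycle as soon as it first returns to a
   vertex it has visited. *)
Lemma cycle_of_nonbacktracking W F (f : dart G -> dart G) x0 :
  x0.1 \in inner W F ->
  (forall x, x.1 \in inner W F ->
     [/\ (f x).1 \in inner W F, tail (f x) = head x & (f x).1 != x.1]) ->
  ~ acyclic_sub W F.
Proof.
move=> x0D fP acy; pose g k := iter k f x0; pose t k := tail (g k).
have gD k : (g k).1 \in inner W F by elim: k => //= k /fP[].
have gS k : t k.+1 = head (g k) by have [_] := fP _ (gD k).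
have gB k : (g k.+1).1 != (g k).1 by have [_ _] := fP _ (gD k).
have repeat : exists j, ~~ uniq (mkseq t j.+1).
  exists #|vertex G|; apply/negP => /card_uniqP.
  by rewrite size_mkseq => tcard;
    have := max_card (mem (mkseq t #|vertex G|.+1)); rewrite tcard ltnn.
(* [j] is the first time a vertex is revisited: [t 0], ..., [t (j - 1)] are distinct and [t j = t i]
   for some [i < j]. The darts at times [i], ..., [j - 1] will form the cycle. *)
case: (ex_minnP repeat) => j tj jmin.
have tU : uniq (mkseq t j).
  by case: j {tj} jmin => // j /(_ j); case: uniq => // /(_ isT); lia.
have t_inj a b : a < j -> b < j -> t a = t b -> a = b.
  by move=> aj bj; move/mkseq_uniqP: tU; apply; rewrite inE.
have [i ij tij] : exists2 i, i < j & t j = t i.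
  move: tj; rewrite /mkseq -addn1 iotaD map_cat /= cats1 rcons_uniq tU andbT negbK.
  by case/mapP=> i; rewrite mem_iota => ? ?; exists i.
pose s := traject f (g i) (j - i).
have sP x : x \in s -> exists2 k, i <= k < j & x = g k.
  case/trajectP=> k kj ->; exists (k + i); first by lia.
  by rewrite /g iterD.
apply: (acy s); last first.
  by move=> x /sP[k _ ->]; have := gD k; rewrite inner_dart => /and3P[-> ->].
have tail_inj : {in s &, injective (@tail G)}.
  move=> _ _ /sP[a /andP[_ aj] ->] /sP[b /andP[_ bj] ->] /t_inj-> //.
have sU : uniq s.
  apply/(uniqP (g i)) => a b; rewrite /s !inE !size_traject => aj bj.
  rewrite !nth_traject // -!iterD -!/(g _) => gab.
  suff : a + i = b + i by lia.
  by apply: t_inj; rewrite ?/t ?gab //; lia.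
(* If both orientations of an edge occur, at times [a < b] say, then the cycle
   visits [t a = t b.+1] and [t b = t a.+1], which forces [b = a.+1]. *)
have no_flip a b : i <= a < j -> i <= b < j -> a < b -> g b != flip (g a).
  move=> aij bij ab; apply/eqP => gba.
  have tb : t a.+1 = t b by rewrite gS /t gba.
  have {tb} tb : a.+1 = b by apply: t_inj => //; lia.
  by have := gB a; rewrite tb gba eqxx.
apply/and4P; split.
- by rewrite -size_eq0 size_traject; lia.
- case jE : (j - i) => [|m]; first by lia.
  rewrite /s jE /= rcons_path last_traject; apply/andP; split.
    apply: (sub_in_path (P := [pred x | x.1 \in inner W F]) (e := frel f)).
    + by move=> x y /= /fP[_ fx _] _ /eqP <-; rewrite fx.
    + apply/allP=> x; rewrite -[_ :: _]/(traject f (g i) m.+1) -jE => /sP[k _ ->].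
      exact: gD.
    + exact: fpath_traject.
  rewrite -iterD -/(g _) -gS; have -> : (m + i).+1 = j by lia.
  by rewrite tij.
- by rewrite map_inj_in_uniq.
- rewrite map_inj_in_uniq // => _ _ /sP[a aij ->] /sP[b bij ->].
  case/same_edge=> // gba; case: (ltngtP a b) => [ab|ba|-> //].
    by have := no_flip a b aij bij ab; rewrite gba eqxx.
  by have := no_flip b a bij aij ba; rewrite gba flipK eqxx.
Qed.

(** Its cardinality is the degree of [v] in the subgraph. *)
Definition inner_darts W F v : {set dart G} :=
  [set x : dart G | (x.1 \in inner W F) && (tail x == v)].

Lemma in_inner_darts W F v x :
  (x \in inner_darts W F v) = (x.1 \in inner W F) && (tail x == v).
Proof. exact: in_set. Qed.

(** If every vertex of [W] had two inner darts, each inner dart could be continued along a different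
    edge, and the resulting walk would contain a cycle. *)
Lemma acyclic_leaf W F :
  acyclic_sub W F -> W != set0 ->
  exists2 v, v \in W & #|inner_darts W F v| <= 1.
Proof.
move=> acy /set0Pn[w wW]; apply/exists_inP; apply: contraT.
rewrite negb_exists_in => /forall_inP deg2; exfalso.
have next x : x.1 \in inner W F -> exists y,
    [&& y.1 \in inner W F, tail y == head x & y.1 != x.1].
  rewrite inner_dart => /and3P[_ _ /deg2]; rewrite -ltnNge => /card_gt1P.
  case=> y [z [+ + yz]]; rewrite !in_inner_darts => /andP[yD yt] /andP[zD zt].
  have [yx|yx] := eqVneq y.1 x.1; last by exists y; rewrite yD yt.
  (* Two distinct darts leaving [head x] cannot both lie on the edge of [x]: they would be flips of
     each other, making that edge a loop. *)
  exists z; rewrite zD zt; apply: contraNneq yz => zx.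
  have [yz|zy] : z = y \/ z = flip y by apply: same_edge; rewrite yx zx.
    by rewrite yz.
  have := loopless y.1; have : head y == tail y.
    by rewrite (eqP yt) -(eqP zt) zy tail_flip.
  by case: (y) => e []; rewrite /head /tail /= => /eqP ->; rewrite eqxx.
(* By [next], the default [x] is never taken on a dart of the subgraph. *)
pose f x := odflt x [pick y | [&& y.1 \in inner W F, tail y == head x & y.1 != x.1]].
have := deg2 w wW; rewrite -ltnNge => /card_gt1P[x0 [_ [+ _ _]]].
rewrite in_inner_darts => /andP[x0D _].
apply: (@cycle_of_nonbacktracking W F f x0) => // x /next[y yP]; rewrite /f.
by case: pickP => [z /and3P[? /eqP ? ?]|/(_ y)] //; rewrite yP.
Qed.

(** Induction on the order of [W]: deleting a leaf keeps the subgraph acyclic and loses at most one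
    edge. *)
Lemma acyclic_inner W F :
  acyclic_sub W F -> W != set0 -> #|inner W F| < #|W|.
Proof.
have [n] := ubnP #|W|; elim: n => // n IHn in W * => Wn acy W0.
have [v vW vleaf] := acyclic_leaf acy W0.
have Wcard : #|W| = #|W :\ v|.+1 by rewrite (cardsD1 v) vW.
have innerE : inner W F \subset
    inner (W :\ v) F :|: [set x.1 | x in inner_darts W F v].
  apply/subsetP => e eW; have := eW; rewrite !inE => /and3P[eF e0 e1].
  have [v0|v0] := eqVneq (ends e false) v.
    by rewrite (imset_f _ (x := (e, false))) ?orbT // in_inner_darts eW /tail v0 eqxx.
  have [v1|v1] := eqVneq (ends e true) v.
    by rewrite (imset_f _ (x := (e, true))) ?orbT // in_inner_darts eW /tail v1 eqxx.
  by rewrite eF e0 e1.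
have le1 : #|[set x.1 | x in inner_darts W F v]| <= 1.
  exact: leq_trans (leq_imset_card _ _) vleaf.
have {innerE} := subset_leq_card innerE.
have := cardsU (inner (W :\ v) F) [set x.1 | x in inner_darts W F v].
(* The induction hypothesis asks for a nonempty set, so a single vertex is treated apart: an inner
   edge there would be a loop. *)
have [WvE|Wv0] := eqVneq (W :\ v) set0.
  have leaf0 : [set x.1 | x in inner_darts W F v] = set0.
    apply/setP=> e; rewrite in_set0; apply/imsetP => -[x].
    rewrite in_inner_darts inner_dart => /andP[/and3P[_ tW hW] _] _.
    have Wv u : u \in W -> u = v.
      by apply: contraTeq => uv; have /setP/(_ u) := WvE; rewrite !inE uv /= => ->.
    have := loopless x.1; move: (Wv _ tW) (Wv _ hW).
    by case: (x) => e' []; rewrite /head /tail /= => -> ->; rewrite eqxx.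
  have -> : inner (W :\ v) F = set0 by apply/setP=> e; rewrite WvE !inE !andbF.
  by rewrite leaf0 setU0 cards0 Wcard; lia.
have acyv : acyclic_sub (W :\ v) F.
  move=> s cs sW; apply: (acy s cs) => x /sW /andP[-> /=].
  by rewrite inE => /andP[].
have : #|inner (W :\ v) F| < #|W :\ v| by apply: IHn => //; lia.
lia.
Qed.

(** * Edge and degree counts across a cut *)

Lemma boundaryC W : boundary (~: W) = boundary W.
Proof. by apply/setP=> e; rewrite !inE; do 2 case: (_ \in W). Qed.

(** This transfers the tree counts, made after the bond is deleted, to counts in the whole graph. *)
Lemma inner_boundary W : inner W (~: boundary W) = inner W setT.
Proof. by apply/setP=> e; rewrite !inE; do 2 case: (_ \in W). Qed.

Lemma card_sum_nat (T : finType) (P : pred T) : #|[set e | P e]| = \sum_e (P e : nat).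
Proof. by rewrite -sum1dep_card big_mkcond; apply: eq_bigr => e _; case: (P e). Qed.

Lemma card_edge_split W :
  #|inner W setT| + #|inner (~: W) setT| + #|boundary W| = #|edge G|.
Proof.
rewrite !card_sum_nat -!big_split /= -sum1_card; apply: eq_bigr => e _.
by rewrite !inE; do 2 case: (_ \in W).
Qed.

(** Both sides count the darts with tail in [W]: an inner edge carries two of them, a boundary edge
    one. *)
Lemma sum_degree W :
  \sum_(v in W) degree v = (#|inner W setT|).*2 + #|boundary W|.
Proof.
have -> : \sum_(v in W) degree v = \sum_(x : dart G) (tail x \in W : nat).
  under eq_bigr do rewrite /degree card_sum_nat.
  rewrite exchange_big /=; apply: eq_bigr => x _.
  have [xW|xW] := boolP (tail x \in W).
    by rewrite (bigD1 (tail x)) //= eqxx big1 // => v /andP[_ /negbTE];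
      rewrite eq_sym => ->.
  by apply: big1 => v vW; case: eqP => // xv; rewrite xv vW in xW.
transitivity (\sum_(e : edge G) \sum_(b : bool) (ends e b \in W : nat)).
  by rewrite pair_big; apply: eq_bigr => -[].
rewrite -addnn !card_sum_nat -!big_split /=; apply: eq_bigr => e _.
by rewrite big_bool !inE; do 2 case: (_ \in W).
Qed.

(** * The two sides of a bond *)

Lemma boundary_neq0 X :
  connected_graph G -> X != set0 -> X != setT -> boundary X != set0.
Proof.
case=> _ conG /set0Pn[u uX].
rewrite -subTset => /subsetPn[w _ wX].
have [//|//|a [b [/and3P[_ _ /existsP[x /and3P[_ /eqP xa /eqP xb]]] aX bX]]] :=
  connect_crossing (conG u w _ _) uX wX; rewrite ?inE //.
apply/set0Pn; exists x.1; rewrite inE; move: aX bX; rewrite -xa -xb.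
by case: (x) => e []; rewrite /head /tail /= => -> /negbTE ->.
Qed.

Lemma component_eq F T u :
  T \in components F -> u \in T -> T = [set v | connect (adj setT F) u v].
Proof.
case/imsetP=> u0 _ ->; rewrite inE => u0u; apply/setP => v; rewrite !inE.
exact: same_connect (sym_connect_sym (adj_sym _ _)) _ _ u0u v.
Qed.

Lemma boundary_component B T : T \in components (~: B) -> boundary T \subset B.
Proof.
move=> TC; apply/subsetP => e; rewrite inE; apply: contraR => eB.
have e_adj b : adj setT (~: B) (ends e b) (ends e (~~ b)).
  rewrite /adj !inE; apply/existsP; exists (e, b).
  by rewrite inE eB /head /tail !eqxx.
have eT b : ends e b \in T -> ends e (~~ b) \in T.
  by move=> /(component_eq TC) ->; rewrite inE connect1.
by apply/eqP; apply/idP/idP; [apply: (eT false) | apply: (eT true)].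
Qed.

(** Each component has a nonempty boundary contained in [B], which is all of [B] by minimality of
    the bond. *)
Lemma hamilton_bond_sides B T1 T2 :
  connected_graph G -> is_bond B ->
  T1 \in components (~: B) -> T2 \in components (~: B) -> T1 != T2 ->
  boundary T1 = B /\ T2 = ~: T1.
Proof.
move=> conG /minsetP[_ Bmin] C1 C2 T12.
have ne0 T : T \in components (~: B) -> T != set0.
  by case/imsetP=> u _ ->; apply/set0Pn; exists u; rewrite inE.
have disj u : u \in T1 -> u \notin T2.
  move=> u1; apply: contra T12 => u2.
  by rewrite (component_eq C1 u1) (component_eq C2 u2).
have boundE T : T \in components (~: B) -> T != setT -> boundary T = B.
  move=> TC TT; apply: Bmin (boundary_component TC).
  by rewrite boundary_neq0 ?ne0 // andbT; apply/existsP; exists T.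
have b1 : boundary T1 = B.
  apply: boundE => //; have /set0Pn[u u2] := ne0 _ C2.
  by apply: contraTneq u2 => T1T; apply: disj; rewrite T1T inE.
have b2 : boundary T2 = B.
  apply: boundE => //; have /set0Pn[u u1] := ne0 _ C1.
  by apply: contraTneq u1 => T2T; apply: contraTN isT => /disj; rewrite T2T inE.
split=> //.
have cover : T1 :|: T2 = setT.
  apply/eqP; apply: contraTT isT => T12T.
  (* As [T1] and [T2] are disjoint, an edge leaving their union leaves exactly one of them, yet both
     boundaries equal [B]. *)
  have /set0Pn[e] : boundary (T1 :|: T2) != set0.
    apply: boundary_neq0 => //; have /set0Pn[u u1] := ne0 _ C1.
    by apply/set0Pn; exists u; rewrite inE u1.
  have := erefl (e \in B); rewrite -{1}b1 -b2 !inE.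
  move: (disj (ends e false)) (disj (ends e true)).
  by do 4 case: (_ \in _) => //=; move=> /(_ isT) // _ /(_ isT).
apply/setP=> u; rewrite inE; apply/idP/idP; first exact: contraTN (disj u).
by have /orP[->|] : (u \in T1) || (u \in T2) by rewrite -in_setU cover inE.
Qed.

(** * Euler's formula and the bound on the end-trees *)

(** The face orbits split the [2 * #|edge G|] darts into triples, which eliminates the number of
    faces from Euler's formula. *)
Lemma triangulation_edges (r : rotation_system G) :
  plane_triangulation r -> #|edge G| + 6 = 3 * #|vertex G|.
Proof.
case=> -[_ euler] tri.
have face_inj : injective (face r).
  by move=> x y /(@rot_inj _ r) /(can_inj flipK).
have : fcard (face r) (dart G) * 3 = #|dart G|.
  apply: fcard_order_set => //; apply/subsetP=> x _.
  by rewrite inE -size_orbit; have [_ ->] := tri x.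
rewrite card_prod card_bool; lia.
Qed.

Lemma end_trees_le (r : rotation_system G) B T1 T2 :
  in_H r -> is_hamilton_bond B ->
  T1 \in components (~: B) -> T2 \in components (~: B) -> T1 != T2 ->
  #|T1| <= #|T2| + 3.
Proof.
move=> [[_ conG _] tri deg6] [bond trees] C1 C2 T12.
have [bE T2E] := hamilton_bond_sides conG bond C1 C2 T12.
have [con1 acy1] := trees _ C1; have [con2 acy2] := trees _ C2.
(* Acyclicity bounds the edges of [T1] from above; connectedness bounds those of [T2] from below. *)
have e1 := acyclic_inner acy1 con1.1.
have e2 := connected_inner con2.
rewrite -bE inner_boundary in e1; rewrite -bE -boundaryC -T2E inner_boundary in e2.
have nE : #|T1| + #|T2| = #|vertex G| by rewrite T2E cardsC.
have := triangulation_edges tri.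
have := card_edge_split T2; have -> : ~: T2 = T1 by rewrite T2E setCK.
have : \sum_(v in T2) degree v <= #|T2| * 6.
  by rewrite -sum_nat_const; apply: leq_sum.
(* Let [T1] and [T2] have [n1], [n2] vertices and [i1], [i2] inner edges. Subtracting the edge count
   from the degree count cancels the boundary: [i2 - i1 <= 3 (n2 - n1) + 6]. The tree counts give
   [n2 - n1 <= i2 - i1]. *)
rewrite sum_degree; lia.
Qed.

End Graph.

Theorem theorem5p2 (G : mgraph) (r : rotation_system G) (HG : in_H r)
  (B : {set edge G}) (HB : is_hamilton_bond B) (T1 T2 : {set vertex G})
  (HT1 : T1 \in components (~: B)) (HT2 : T2 \in components (~: B))
  (HT12 : T1 != T2) :
  (`|(#|T1|) - (#|T2|)| <= 3)%N.
Proof.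
have le12 := end_trees_le HG HB HT1 HT2 HT12.
have := end_trees_le HG HB HT2 HT1; rewrite eq_sym => /(_ HT12) le21.
lia.
Qed.
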